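(* For every word $u \in A^*$, the shape of the $\mathbb{P}$-symbol of $u$ is a pair of twin binary trees.
   Context: $A = \{a_1 < a_2 < \cdots\}$ is a totally ordered infinite alphabet and $A^*$ is the free monoid on $A$. Binary trees: planar binary trees in which each internal node has a left and a right child (possibly a leaf); a tree with $n$ internal nodes (called nodes) has $n+1$ leaves, and the empty tree (a single leaf) is denoted $\perp$. The canopy $\mathrm{cnp}(T)$ of a binary tree $T$ is the word on $\{0,1\}$ obtained by reading the leaves of $T$ from left to right, omitting the first and the last one, writing $0$ if the leaf is oriented to the right (is the right child of its parent) and $1$ otherwise. A pair of twin binary trees is a pair $(T_L,T_R)$ of binary trees with the same number $n$ of nodes whose canopies are complementary: $\mathrm{cnp}(T_L)_i \neq \mathrm{cnp}(T_R)_i$ for all $1 \leq i \leq n-1$. A binary tree with nodes labeled by $A$ is a left (resp. right) binary search tree if for every node labeled $b$, every label $a$ in its left subtree and every label $c$ in its right subtree satisfy $a < b \leq c$ (resp. $a \leq b < c$). Leaf insertion of a letter $a$ into a left (resp. right) binary search tree $T$: if $T = \perp$, the result is the one-node tree labeled $a$; otherwise, if the label $b$ of the root satisfies $a < b$ (resp. $a \leq b$), leaf-insert $a$ into the left subtree, else leaf-insert $a$ into the right subtree. For a right binary search tree $T$ and a letter $b$, $T_{\leq b}$ (resp. $T_{>b}$) is the right binary search tree made exactly of the nodes of $T$ with label $\leq b$ (resp. $> b$) and such that, for nodes $x,y$, if $x$ is an ancestor of $y$ in the restricted tree then $x$ is an ancestor of $y$ in $T$. Root insertion of $a$ into a right binary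 search tree $T$ yields the tree whose root is a new node labeled $a$, with left subtree $T_{\leq a}$ and right subtree $T_{>a}$. The $\mathbb{P}$-symbol $\mathbb{P}(u) = (T_L, T_R)$ of a word $u \in A^*$ is obtained starting from $(\perp,\perp)$ by inserting the letters of $u$ one by one from left to right, where inserting a letter $a$ into $(T_L,T_R)$ means making a leaf insertion of $a$ into the left binary search tree $T_L$ and a root insertion of $a$ into the right binary search tree $T_R$. The shape of a pair of labeled trees is the pair of unlabeled trees obtained by forgetting the labels. *)

(* Defs.v *)
From mathcomp Require Import all_boot all_order.
From Stdlib Require Import ClassicalEpsilon.

Set Implicit Arguments.
Unset Strict Implicit.
Unset Printing Implicit Defensive.

Import Order.TTheory.
Local Open Scope order_scope.

Inductive btree (L : Type) : Type :=
| Leaf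
| Node (l : btree L) (x : L) (r : btree L).
Arguments Leaf {L}.

(* Unlabeled binary trees are the trees labeled by [unit]. *)
Fixpoint shape (L : Type) (T : btree L) : btree unit :=
  if T is Node l _ r then Node (shape l) tt (shape r) else Leaf.

Fixpoint nb_nodes (L : Type) (T : btree L) : nat :=
  if T is Node l _ r then (nb_nodes l + nb_nodes r).+1 else 0%N.

(* [leaf_word d T] has one bit per leaf of T, from left to right: [false] (0)
   for a right child and [true] (1) for a left child.  The bit [d] is the one
   given to T itself when T is a leaf. *)
Fixpoint leaf_word (L : Type) (d : bool) (T : btree L) : seq bool :=
  if T is Node l _ r then leaf_word true l ++ leaf_word false r else [:: d].

Definition drop_ends (s : seq bool) : seq bool := behead (take (size s).-1 s).

(* The initial bit is irrelevant: it only shows up in the word of the empty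
   tree, whose single leaf is omitted. *)
Definition canopy (L : Type) (T : btree L) : seq bool :=
  drop_ends (leaf_word true T).

Definition twin (T : btree unit * btree unit) : Prop :=
  nb_nodes T.1 = nb_nodes T.2 /\
  forall i : nat, (i < (nb_nodes T.1).-1)%N ->
    nth false (canopy T.1) i != nth false (canopy T.2) i.

Fixpoint labels (L : Type) (T : btree L) : seq L :=
  if T is Node l x r then labels l ++ x :: labels r else [::].

(* A node is identified by its address, the path from the root to it
   ([false] = go left, [true] = go right); ancestors are then prefixes.  A node counts as an
   ancestor of itself, which is immaterial in [is_restriction]. *)
Fixpoint label_at (L : Type) (T : btree L) (p : seq bool) : option L :=
  match T, p with
  | Leaf, _ => None
  | Node _ x _, [::] => Some x
  | Node l _ _, false :: p' => label_at l p'
  | Node _ _ r, true :: p' => label_at r p'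
  end.

Definition is_node (L : Type) (T : btree L) : pred (seq bool) :=
  fun p => isSome (label_at T p).

Definition ancestor (p q : seq bool) : bool := prefix p q.

Section SearchTrees.
Context {d : Order.disp_t} {A : orderType d}.
Implicit Types (T : btree A) (a b : A).

Fixpoint left_bst T : bool :=
  if T is Node l b r then
    [&& all (fun a => a < b) (labels l), all (fun c => b <= c) (labels r),
        left_bst l & left_bst r]
  else true.

Fixpoint right_bst T : bool :=
  if T is Node l b r then
    [&& all (fun a => a <= b) (labels l), all (fun c => b < c) (labels r),
        right_bst l & right_bst r]
  else true.

Fixpoint left_leaf_insert a T : btree A :=
  if T is Node l b r then
    if a < b then Node (left_leaf_insert a l) b r
    else Node l b (left_leaf_insert a r)
  else Node Leaf a Leaf.

(* Labels may be repeated, so that the nodes of T' are nodes of T is expressed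
   by a label-preserving bijection [phi] from the nodes of T' to the nodes of T
   whose label satisfies P. *)
Definition is_restriction (P : pred A) T T' : Prop :=
  right_bst T' /\
  exists phi : seq bool -> seq bool,
  [/\ forall p x, label_at T' p = Some x ->
        label_at T (phi p) = Some x /\ P x,
      {in is_node T' &, injective phi},
      forall q x, label_at T q = Some x -> P x ->
        exists2 p, is_node T' p & phi p = q
    & {in is_node T' &,
        forall p q, ancestor p q -> ancestor (phi p) (phi q)}].

(* Existence and uniqueness, for a right binary search tree T and the two
   predicates used below, are [restr_le_unique] and [restr_gt_unique]. *)
Definition restr (P : pred A) T : btree A :=
  epsilon (inhabits Leaf) (is_restriction P T).

Definition restr_le b T : btree A := restr (fun x => x <= b) T.
Definition restr_gt b T : btree A := restr (fun x => b < x) T.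

Definition root_insert a T : btree A := Node (restr_le a T) a (restr_gt a T).

Definition insert_letter (T : btree A * btree A) a : btree A * btree A :=
  (left_leaf_insert a T.1, root_insert a T.2).

Definition Psymbol (u : seq A) : btree A * btree A :=
  foldl insert_letter (Leaf, Leaf) u.

Definition pair_shape (T : btree A * btree A) : btree unit * btree unit :=
  (shape T.1, shape T.2).

Lemma mem_labels T x : x \in labels T <-> exists p, label_at T p = Some x.
Proof.
elim: T => [|l IHl y r IHr] /=; first by split=> // -[].
rewrite mem_cat inE; split.
  case/or3P=> [/IHl [p e]|/eqP->|/IHr [p e]].
  - by exists (false :: p).
  - by exists [::].
  - by exists (true :: p).
case=> -[|[] p] /=.
- by case=> ->; rewrite eqxx orbT.
- by move=> e; apply/or3P/Or33/IHr; exists p.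
- by move=> e; apply/or3P/Or31/IHl; exists p.
Qed.

Fixpoint cut (P : pred A) T : btree A :=
  if T is Node l x r then
    if P x then Node (cut P l) x (cut P r)
    else if cut P l is Leaf then cut P r else cut P l
  else Leaf.

Definition convex (P : pred A) :=
  forall x y z, P x -> P z -> x <= y -> y <= z -> P y.

Lemma cut0 P T : (forall x, x \in labels T -> ~~ P x) -> cut P T = Leaf.
Proof.
elim: T => //= l IHl x r IHr H.
have Hin y : (y \in labels l) || (y == x) || (y \in labels r) -> ~~ P y.
  by move=> hy; apply: H; rewrite mem_cat inE orbA.
rewrite (negbTE (Hin x _)) ?eqxx ?orbT // IHl ?IHr // => y hy;
  by apply: Hin; rewrite hy ?orbT.
Qed.

(* The existence part, with the trees and their bijection built together. *)
Lemma cut_restriction P T : convex P -> right_bst T ->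
  is_restriction P T (cut P T).
Proof.
move=> cP; elim: T => [|l IHl x r IHr] /=.
  by move=> _; split=> //; exists id; split.
case/and4P=> /allP hl /allP hr bl br.
have [bl' [f [f1 f2 f3 f4]]] := IHl bl.
have [br' [g [g1 g2 g3 g4]]] := IHr br.
case: ifP => Px.
  split=> /=.
    apply/and4P; split=> //; apply/allP => y /mem_labels [p].
      by move=> /f1 [e _]; apply: hl; apply/mem_labels; exists (f p).
    by move=> /g1 [e _]; apply: hr; apply/mem_labels; exists (g p).
  exists (fun p => match p with [::] => [::] | false :: p => false :: f p
                              | true :: p => true :: g p end).
  split.
  - by case=> [|[] p] y //=; [case=> <-|exact: g1|exact: f1].
  - by case=> [|[] p] [|[] q] // hp hq [] e; congr cons; [exact: g2|exact: f2].
  - case=> [|[] q] y /=; first by case=> _ _; exists [::].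
      by move=> hq /(g3 _ _ hq) [p hp <-]; exists (true :: p).
    by move=> hq /(f3 _ _ hq) [p hp <-]; exists (false :: p).
  - case=> [|[] p] [|[] q] // hp hq; rewrite /ancestor /=;
      by [exact: g4|exact: f4].
have side : (forall y, y \in labels l -> ~~ P y) \/
            (forall y, y \in labels r -> ~~ P y).
  case: (boolP (all (predC P) (labels l))) => [/allP|/allPn [z zl]]; first by left.
  rewrite negbK => Pz; right=> y yr; apply/negP => Py.
  by move: Px; rewrite (cP z x y) ?hl // ltW // hr.
have liftR : (forall y, y \in labels l -> ~~ P y) ->
    is_restriction P (Node l x r) (cut P r).
  move=> Hl; split=> //; exists (fun p => true :: g p); split=> //.
  - by move=> p q hp hq [e]; exact: g2.
  - case=> [|[] q] y /=; first by case=> <-; rewrite Px.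
      by move=> hq /(g3 _ _ hq) [p hp <-]; exists p.
    move=> hq; have: y \in labels l by apply/mem_labels; exists q.
    by move/Hl/negbTE->.
have liftL : (forall y, y \in labels r -> ~~ P y) ->
    is_restriction P (Node l x r) (cut P l).
  move=> Hr; split=> //; exists (fun p => false :: f p); split=> //.
  - by move=> p q hp hq [e]; exact: f2.
  - case=> [|[] q] y /=; first by case=> <-; rewrite Px.
      move=> hq; have: y \in labels r by apply/mem_labels; exists q.
      by move/Hr/negbTE->.
    by move=> hq /(f3 _ _ hq) [p hp <-]; exists p.
case: side => H; first by rewrite (cut0 H); exact: liftR.
case E: (cut P l) => [|l' y r']; last by rewrite -E; exact: liftL.
by rewrite (cut0 H) -E; exact: liftL.
Qed.

(* T' is an arrangement of the set S of nodes of T. *)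
Definition arranges T (S : seq bool -> Prop) T' : Prop :=
  right_bst T' /\
  exists phi : seq bool -> seq bool,
  [/\ forall p x, label_at T' p = Some x ->
        label_at T (phi p) = Some x /\ S (phi p),
      {in is_node T' &, injective phi},
      forall q, S q -> exists2 p, is_node T' p & phi p = q
    & {in is_node T' &, forall p q, prefix p q -> prefix (phi p) (phi q)}].

Lemma arranges_root T S l x r : arranges T S (Node l x r) ->
  exists2 q0, label_at T q0 = Some x /\ S q0 &
  [/\ forall q, S q -> prefix q0 q,
      arranges T (fun q => S q /\ q <> q0 /\
        exists2 y, label_at T q = Some y & y <= x) l
    & arranges T (fun q => S q /\ q <> q0 /\
        exists2 y, label_at T q = Some y & x < y) r].
Proof.
case=> /= /and4P [/allP hl /allP hr bl br] [f [f1 f2 f3 f4]].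
exists (f [::]); first exact: (f1 [::]).
have f0 (b : bool) p : is_node (Node l x r) (b :: p) -> f (b :: p) <> f [::].
  by move=> hp e; have := f2 (b :: p) [::] hp isT e.
split.
- by move=> q /f3 [p hp <-]; exact: (f4 [::] p isT hp (prefix0s p)).
- split=> //; exists (fun p => f (false :: p)); split.
  + move=> p y e; have [e1 e2] := f1 (false :: p) y e; do 2!split=> //.
    split; first by apply: f0; rewrite /is_node /= e.
    by exists y => //; apply: hl; apply/mem_labels; exists p.
  + by move=> p q hp hq e; have [] := f2 (false :: p) (false :: q) hp hq e.
  + move=> q [/f3 [[|[] p] hp <-] [ne [y ey le]]] //; last by exists p.
    case e: (label_at r p) hp => [z|]; rewrite /is_node /= e // => _.
    have: y \in labels r; last by move/hr; rewrite ltNge le.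
    apply/mem_labels; exists p; rewrite e; congr Some.
    by have [] := f1 (true :: p) z e; rewrite ey => -[].
  + by move=> p q hp hq pq; apply: (f4 (false :: p) (false :: q)); rewrite //= eqxx.
- split=> //; exists (fun p => f (true :: p)); split.
  + move=> p y e; have [e1 e2] := f1 (true :: p) y e; do 2!split=> //.
    split; first by apply: f0; rewrite /is_node /= e.
    by exists y => //; apply: hr; apply/mem_labels; exists p.
  + by move=> p q hp hq e; have [] := f2 (true :: p) (true :: q) hp hq e.
  + move=> q [/f3 [[|[] p] hp <-] [ne [y ey le]]] //; first by exists p.
    case e: (label_at l p) hp => [z|]; rewrite /is_node /= e // => _.
    have: y \in labels l; last by move/hl; rewrite leNgt le.
    apply/mem_labels; exists p; rewrite e; congr Some.
    by have [] := f1 (false :: p) z e; rewrite ey => -[].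
  + by move=> p q hp hq pq; apply: (f4 (true :: p) (true :: q)); rewrite //= eqxx.
Qed.

Lemma arranges_uniq T S T1 T2 : arranges T S T1 -> arranges T S T2 -> T1 = T2.
Proof.
elim: T1 T2 S => [|l1 IHl x1 r1 IHr] [|l2 x2 r2] S //.
- case=> _ [f [_ _ f3 _]] /arranges_root [q [_ /f3 [p]]] //.
- move=> /arranges_root [q [_ Sq]] _ [_ [f [_ _ f3 _]]].
  by have [] := f3 _ Sq.
move=> /arranges_root [q1 [e1 S1] [p1 L1 R1]].
move=> /arranges_root [q2 [e2 S2] [p2 L2 R2]].
have qq : q1 = q2.
  have := p1 _ S2; have := p2 _ S1.
  move=> /prefixP [s ->] /prefixP [t].
  rewrite -catA -[LHS]cats0 => /eqP; rewrite eqseq_cat // eqxx /=.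
  by case: s => [|? ?]; rewrite ?cats0.
subst q2; move: e2; rewrite e1 => -[ex]; subst x2.
by rewrite (IHl _ _ L1 L2) (IHr _ _ R1 R2).
Qed.

Lemma restriction_arranges P T T' : is_restriction P T T' ->
  arranges T (fun q => exists2 x, label_at T q = Some x & P x) T'.
Proof.
case=> b [f [f1 f2 f3 f4]]; split=> //; exists f; split=> //.
- by move=> p x /f1 [e Px]; split=> //; exists x.
- by move=> q [x e Px]; apply: f3 e Px.
Qed.

Lemma restriction_unique P T : convex P -> right_bst T ->
  exists! T', is_restriction P T T'.
Proof.
move=> cP bT; exists (cut P T); split; first exact: cut_restriction.
move=> T' /restriction_arranges; apply: arranges_uniq.
exact/restriction_arranges/cut_restriction.
Qed.

Lemma restr_le_unique b T : right_bst T ->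
  exists! T', is_restriction (fun x => x <= b) T T'.
Proof.
by apply: restriction_unique => x y z _ zb _ yz; exact: le_trans yz zb.
Qed.

Lemma restr_gt_unique b T : right_bst T ->
  exists! T', is_restriction (fun x => b < x) T T'.
Proof. by apply: restriction_unique => x y z bx _ xy _; exact: lt_le_trans bx xy. Qed.

Lemma restrP P T : convex P -> right_bst T -> is_restriction P T (restr P T).
Proof.
move=> cP bT; apply: epsilon_spec.
by have [T' [hT' _]] := restriction_unique cP bT; exists T'.
Qed.

Lemma mem_left_leaf_insert a T x :
  (x \in labels (left_leaf_insert a T)) = (x == a) || (x \in labels T).
Proof.
elim: T => [|l IHl b r IHr] //=.
case: ifP => _ /=; rewrite !mem_cat !inE ?IHl ?IHr ?orbA //.
by rewrite [_ || (x == a)]orbC !orbA.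
Qed.

Lemma left_leaf_insert_bst a T : left_bst T -> left_bst (left_leaf_insert a T).
Proof.
elim: T => [|l IHl b r IHr] //= /and4P [/allP hl /allP hr bl br].
case: ltP => ab /=; apply/and4P; split; rewrite ?IHl ?IHr //; apply/allP=> //.
  by move=> x; rewrite mem_left_leaf_insert => /predU1P [-> //|/hl].
by move=> x; rewrite mem_left_leaf_insert => /predU1P [-> //|/hr].
Qed.

Lemma root_insert_bst a T : right_bst T -> right_bst (root_insert a T).
Proof.
move=> bT; have cle : convex (fun x => x <= a).
  by move=> x y z _ za _ yz; exact: le_trans yz za.
have clt : convex (fun x => a < x).
  by move=> x y z ax _ xy _; exact: lt_le_trans ax xy.
have [bl [f [f1 _ _ _]]] := restrP cle bT.
have [br [g [g1 _ _ _]]] := restrP clt bT.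
rewrite /=; apply/and4P; split=> //; apply/allP => x /mem_labels [p].
  by move=> /f1 [].
by move=> /g1 [].
Qed.

(* Every insertion made in [Psymbol] is into a search tree of the right kind,
   so that [restr] is only used where it is well defined. *)
Lemma Psymbol_bst u : left_bst (Psymbol u).1 /\ right_bst (Psymbol u).2.
Proof.
elim/last_ind: u => [|u a [IHl IHr]] //.
rewrite /Psymbol foldl_rcons; split.
  exact: left_leaf_insert_bst.
exact: root_insert_bst.
Qed.

End SearchTrees.

(* Main.v *)
Require Import Defs.
From mathcomp Require Import all_boot all_order.
From mathcomp Require Import zify.

(** Both trees of the P-symbol of [u] carry the letters of [u] in the same
    in-order: sorted by value, equal letters by position.  The leaf lying
    between two consecutive nodes is a right child exactly when the second of
    these nodes is an ancestor of the first.  Leaf insertion puts a new letter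
    below all the older ones and root insertion puts it above them, neither of
    them changing how the older nodes sit above one another; so the leaf of the
    left tree and that of the right tree always have opposite orientations.

    The proof expresses this through the effect of one insertion on the words
    of leaf orientations.  Let [w] be the word of a tree with [n] nodes (so [w]
    has [n.+1] bits), and let [k] be the number of labels at most [a].
    Inserting [a] replaces the bit of rank [k] of [w] by two bits and keeps all
    the others: leaf insertion writes [true; false]
    ([leaf_word_left_leaf_insert]), and root insertion writes
    [k == 0; k < n] ([leaf_word_root_insert]).  Unless they stand at an end of
    the word, the latter bits are [false; true].  Since both trees have the
    same labels up to permutation ([perm_Psymbol]), [k] and [n] are common to
    the two insertions, and complementarity of the inner bits is preserved. *)

Set Implicit Arguments.
Unset Strict Implicit.
Unset Printing Implicit Defensive.

Import Order.TTheory.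

(** * Leaf words and canopies *)

Section LeafWords.
Context {L : Type}.
Implicit Type T : btree L.

Lemma size_leaf_word e T : size (leaf_word e T) = (nb_nodes T).+1.
Proof. by elim: T e => //= l IHl x r IHr e; rewrite size_cat IHl IHr addnS. Qed.

Lemma size_labels T : size (labels T) = nb_nodes T.
Proof. by elim: T => //= l IHl x r IHr; rewrite size_cat /= IHl IHr addnS. Qed.

Lemma nb_nodes_shape T : nb_nodes (Defs.shape T) = nb_nodes T.
Proof. by elim: T => //= l -> x r ->. Qed.

Lemma leaf_word_shape e T : leaf_word e (Defs.shape T) = leaf_word e T.
Proof. by elim: T e => //= l IHl x r IHr e; rewrite IHl IHr. Qed.

Lemma nth_canopy T i : i < (nb_nodes T).-1 ->
  nth false (canopy T) i = nth false (leaf_word true T) i.+1.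
Proof.
move=> lt_i; rewrite /canopy /drop_ends nth_behead nth_take //.
by rewrite size_leaf_word; lia.
Qed.

End LeafWords.

Definition split_bit (k : nat) (b1 b2 : bool) (w : seq bool) : seq bool :=
  take k w ++ [:: b1, b2 & drop k.+1 w].

Lemma nth_split_bit k b1 b2 w i : k < size w ->
  nth false (split_bit k b1 b2 w) i =
    if i < k then nth false w i
    else if i == k then b1
    else if i == k.+1 then b2
    else nth false w i.-1.
Proof.
move=> lt_k; rewrite /split_bit nth_cat size_takel ?(ltnW lt_k) //.
case: ltnP => [lt_ik | le_ki]; first by rewrite nth_take.
rewrite -(subnKC le_ki) addKn; case: (i - k) => [|[|j]] /=.
- by rewrite addn0 eqxx.
- by rewrite addn1 (gtn_eqF (ltnSn k)) eqxx.
- have -> : (k + j.+2 == k) = false by lia.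
  have -> : (k + j.+2 == k.+1) = false by lia.
  by rewrite nth_drop; congr nth; lia.
Qed.

Lemma split_bit_catl k b1 b2 w1 w2 : k < size w1 ->
  split_bit k b1 b2 (w1 ++ w2) = split_bit k b1 b2 w1 ++ w2.
Proof.
move=> lt_k; rewrite /split_bit takel_cat ?(ltnW lt_k) // -catA /=.
rewrite drop_cat; case: ltnP => // ge_k.
have -> : k.+1 - size w1 = 0 by lia.
by rewrite drop0 [drop _ w1]drop_oversize.
Qed.

Lemma split_bit_catr k b1 b2 w1 w2 :
  split_bit (size w1 + k) b1 b2 (w1 ++ w2) = w1 ++ split_bit k b1 b2 w2.
Proof.
by rewrite /split_bit -addnS takeD take_size_cat // addnC -drop_drop
           drop_size_cat // -catA.
Qed.

(** * The effect of one insertion *)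

Section Insertions.
Context {d : Order.disp_t} {A : orderType d}.
Implicit Types (T : btree A) (a : A).

Local Notation rank a T := (count (fun x => x <= a)%O (labels T)).

Lemma rank_le a T : rank a T <= nb_nodes T.
Proof. by rewrite -size_labels count_size. Qed.

Lemma rank_all a T : (forall x, x \in labels T -> (x <= a)%O) ->
  rank a T = nb_nodes T.
Proof.
by move=> H; rewrite -size_labels; apply/eqP; rewrite -all_count; apply/allP.
Qed.

Lemma rank_none a T : (forall x, x \in labels T -> (a < x)%O) -> rank a T = 0.
Proof.
move=> H; apply/eqP; rewrite -leqn0 leqNgt -has_count; apply/hasPn => x /H.
by rewrite -ltNge.
Qed.

Lemma rank_node a l b r :
  rank a (Node l b r) = rank a l + ((b <= a)%O + rank a r).
Proof. by rewrite /= count_cat. Qed.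

Lemma perm_left_leaf_insert a T :
  perm_eq (labels (left_leaf_insert a T)) (a :: labels T).
Proof.
elim: T => //= l IHl b r IHr; case: ifP => _ /=.
  by rewrite -cat_cons perm_cat2r.
rewrite perm_sym (perm_catCA [:: a]) perm_cat2l.
by rewrite (perm_catCA [:: a] [:: b]) perm_cons perm_sym.
Qed.

(** The new node replaces the leaf that follows the labels at most [a], and
    brings its own two leaves. *)
Lemma leaf_word_left_leaf_insert a e T : left_bst T ->
  leaf_word e (left_leaf_insert a T) =
    split_bit (rank a T) true false (leaf_word e T).
Proof.
elim: T e => //= l IHl b r IHr e /and4P [/allP hl /allP hr bl br].
rewrite -/(labels (Node l b r)) rank_node; case: ltP => ab /=.
  have hra x : x \in labels r -> (a < x)%O by move/hr; exact: lt_le_trans.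
  by rewrite (rank_none hra) !addn0 split_bit_catl ?size_leaf_word ?ltnS ?rank_le // IHl.
have hla x : x \in labels l -> (x <= a)%O.
  by move/hl => xb; exact: le_trans (ltW xb) ab.
by rewrite (rank_all hla) add1n addnS -addSn -(size_leaf_word true) split_bit_catr IHr.
Qed.

Lemma convex_le a : convex (fun x : A => x <= a)%O.
Proof. by move=> x y z _ za _ yz; exact: le_trans yz za. Qed.

Lemma convex_gt a : convex (fun x : A => a < x)%O.
Proof. by move=> x y z ax _ xy _; exact: lt_le_trans ax xy. Qed.

(** Restrictions are unique, so the one chosen by [epsilon] can be computed by
    the recursive [cut]. *)
Lemma restr_cut P T : convex P -> right_bst T -> restr P T = cut P T.
Proof.
move=> cP bT; apply: (arranges_uniq (restriction_arranges (restrP cP bT))).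
exact/restriction_arranges/cut_restriction.
Qed.

Lemma cut_all (P : pred A) T : (forall x, x \in labels T -> P x) -> cut P T = T.
Proof.
elim: T => //= l IHl x r IHr H; rewrite H ?mem_cat ?mem_head ?orbT //.
by rewrite IHl ?IHr // => y hy; rewrite H // mem_cat ?inE hy ?orbT.
Qed.

(** Convexity matters when the root is discarded: no two labels satisfying [P]
    can then lie on both sides of it, and [cut] keeps a single subtree. *)
Lemma labels_cut (P : pred A) T : convex P -> right_bst T ->
  labels (cut P T) = filter P (labels T).
Proof.
move=> cP; elim: T => //= l IHl x r IHr /and4P [/allP hl /allP hr bl br].
rewrite filter_cat /= -IHl // -IHr //; case: ifP => // Px.
case El: (cut P l) => [|l' y r'] //; rewrite [cut P r]cut0 ?cats0 // => z zr.
apply/negP => Pz; have: y \in filter P (labels l).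
  by rewrite -IHl // El /= mem_cat mem_head orbT.
rewrite mem_filter => /andP [Py yl].
by move: Px; rewrite (cP y x z) // ?hl // ltW // hr.
Qed.

Lemma perm_root_insert a T : right_bst T ->
  perm_eq (labels (root_insert a T)) (a :: labels T).
Proof.
move=> bT; rewrite /= /restr_le /restr_gt.
rewrite !restr_cut ?labels_cut //; try exact: convex_le; try exact: convex_gt.
rewrite -cat1s perm_catCA perm_cons.
have -> : filter (fun x => a < x)%O (labels T) =
          filter (predC (fun x => x <= a)%O) (labels T).
  by apply: eq_filter => x /=; rewrite ltNge.
by rewrite perm_filterC.
Qed.

(** In-order, the nodes with label at most [a] form a prefix, so all the bits
    before the leaf that closes this prefix are unchanged.  That leaf becomes
    the last one of the restricted tree, hence a right child, unless this tree
    is empty.  The bits [e] and [e'] are independent because they diverge in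
    the recursion: when the root is discarded, the restriction of the left
    subtree takes the place of the whole tree and keeps [e], whereas the left
    subtree itself is read with the bit [true]. *)
Lemma leaf_word_cut_le a e e' T : right_bst T ->
  leaf_word e (cut (fun x => x <= a)%O T) =
    take (rank a T) (leaf_word e' T) ++ [:: (rank a T == 0) && e].
Proof.
elim: T e e' => //= l IHl b r IHr e e' /and4P [/allP hl /allP hr bl br].
rewrite -/(labels (Node l b r)) rank_node; case: leP => ba /=.
  have hla x : x \in labels l -> (x <= a)%O by move/hl => xb; exact: le_trans xb ba.
  rewrite cut_all // rank_all // add1n addnS -addSn /= (IHr _ false) // andbF.
  rewrite -(size_leaf_word true) takeD take_size_cat // drop_size_cat //.
  by rewrite -catA.
have hra x : x \in labels r -> (a < x)%O by move/hr; exact: lt_trans ba.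
have -> : cut (fun x => x <= a)%O r = Leaf.
  by apply: cut0 => x /hra; rewrite -ltNge.
rewrite (rank_none hra) !addn0 takel_cat; last first.
  by rewrite size_leaf_word ltnW // ltnS rank_le.
by rewrite -IHl //; case: cut.
Qed.

(** The mirror statement: the leaf that opens the suffix of labels greater than
    [a] becomes the first one, hence a left child. *)
Lemma leaf_word_cut_gt a e e' T : right_bst T ->
  leaf_word e (cut (fun x => a < x)%O T) =
    ((rank a T < nb_nodes T) || e) :: drop (rank a T).+1 (leaf_word e' T).
Proof.
elim: T e e' => //= l IHl b r IHr e e' /and4P [/allP hl /allP hr bl br].
rewrite -/(labels (Node l b r)) rank_node; case: ltP => ab /=.
  have hra x : x \in labels r -> (a < x)%O by move/hr; exact: lt_trans ab.
  rewrite [cut _ r]cut_all // (rank_none hra) !addn0 (IHl _ true) // orbT.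
  rewrite ltnS (leq_trans (rank_le a l)) ?leq_addr //= drop_cat size_leaf_word ltnS.
  case: ltnP => // ge_l.
  have -> : rank a l = nb_nodes l by apply/eqP; rewrite eqn_leq rank_le.
  by rewrite subnn drop0 -(size_leaf_word true) drop_size.
have hla x : x \in labels l -> (x <= a)%O by move/hl => xb; exact: le_trans xb ab.
have -> : cut (fun x => a < x)%O l = Leaf.
  by apply: cut0 => x /hla; rewrite -leNgt.
rewrite (IHr _ false) // (rank_all hla) add1n addnS ltnS ltn_add2l.
rewrite -addSn -addnS -(size_leaf_word true) addnC -drop_drop.
by rewrite drop_size_cat.
Qed.

Lemma leaf_word_root_insert a e T : right_bst T ->
  leaf_word e (root_insert a T) =
    split_bit (rank a T) (rank a T == 0) (rank a T < nb_nodes T)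
              (leaf_word e T).
Proof.
move=> bT; rewrite /= /restr_le /restr_gt.
rewrite !restr_cut //; try exact: convex_le; try exact: convex_gt.
rewrite (leaf_word_cut_le _ _ e) // (leaf_word_cut_gt _ _ e) //.
by rewrite andbT orbF -catA.
Qed.

(** * Complementarity along the insertions *)

Lemma Psymbol_rcons u a : Psymbol (rcons u a) = insert_letter (Psymbol u) a.
Proof. exact: foldl_rcons. Qed.

Lemma perm_Psymbol (u : seq A) :
  perm_eq (labels (Psymbol u).1) u /\ perm_eq (labels (Psymbol u).2) u.
Proof.
elim/last_ind: u => [|u a [IHl IHr]] //; rewrite Psymbol_rcons.
have au v : perm_eq v u -> perm_eq (a :: v) (rcons u a).
  by move=> vu; rewrite perm_sym perm_rcons perm_cons perm_sym.
split; first exact: perm_trans (perm_left_leaf_insert _ _) (au _ IHl).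
apply: perm_trans (au _ IHr); apply: perm_root_insert.
by case: (Psymbol_bst u).
Qed.

Lemma nb_nodes_Psymbol (u : seq A) :
  nb_nodes (Psymbol u).1 = size u /\ nb_nodes (Psymbol u).2 = size u.
Proof.
have [pl pr] := perm_Psymbol u.
by rewrite -!size_labels (perm_size pl) (perm_size pr).
Qed.

Lemma leaf_word_Psymbol_compl (u : seq A) i : 0 < i < size u ->
  nth false (leaf_word true (Psymbol u).1) i !=
  nth false (leaf_word true (Psymbol u).2) i.
Proof.
elim/last_ind: u i => [|u a IHu] i; first by case: i.
rewrite Psymbol_rcons size_rcons => lt_i.
have [bl br] := Psymbol_bst u; have [pl pr] := perm_Psymbol u.
have [nl nr] := nb_nodes_Psymbol u.
rewrite leaf_word_left_leaf_insert // leaf_word_root_insert // nr.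
rewrite (permP pl) (permP pr).
have : count (fun x => x <= a)%O u <= size u by exact: count_size.
move: (count _ u) => k le_k.
rewrite !nth_split_bit ?size_leaf_word ?nl ?nr //.
case: ltnP => [lt_ik | le_ki]; first by apply: IHu; lia.
(* The positions [k] and [k.+1] carry the new bits; as [i] is an inner
   position, [k == 0] fails in the first case and [k < size u] holds in the
   second one. *)
case: (eqVneq i k) => [eq_i | ne_ik]; first by have -> : (k == 0) = false by lia.
case: (eqVneq i k.+1) => [eq_i | ne_ik1]; first by have -> : k < size u by lia.
by apply: IHu; lia.
Qed.

End Insertions.

Theorem proposition4p3 (d : Order.disp_t) (A : orderType d) (a : nat -> A)
    (a_incr : forall i j : nat, (i < j)%N -> (a i < a j)%O)
    (a_surj : forall x : A, exists i : nat, x = a i)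
    (u : seq A) :
  twin (pair_shape (Psymbol u)).
Proof.
have [nl nr] := nb_nodes_Psymbol u.
split=> [|i]; rewrite /= !nb_nodes_shape nl ?nr // => lt_i.
rewrite !nth_canopy ?nb_nodes_shape ?nl ?nr // !leaf_word_shape.
by apply: leaf_word_Psymbol_compl; lia.
Qed.
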